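(* Let $\mathcal{X},\mathcal{H},\Theta,\Xi,H$ and the continuous monotone vector field $\Phi:\Theta\to\mathcal{X}\times\mathcal{H}$ be as in the context, and let $(\Phi,\overline{\eta}(\cdot))$ be $\eta$-regular. Then: (i) A primal vector field $\Psi(\xi)$ induced by $(\Phi,\overline{\eta}(\cdot))$ is monotone on $\Xi$. Moreover, whenever $\mathcal{I}_t=\{\xi_i\in\Xi,\Psi(\xi_i):1\leq i\leq t\}$, $\mathcal{J}_t=\{\theta_i:=[\xi_i;\overline{\eta}(\xi_i)],\Phi(\theta_i):1\leq i\leq t\}$ and $\lambda$ is a $t$-step accuracy certificate, it holds $$\epsilon_{\rm VI}\Big(\sum_{i=1}^t\lambda_i\theta_i\,\Big|\,\Phi,\Theta\Big)\leq\mathrm{Res}(\mathcal{J}_t,\lambda|\Theta)\leq\mathrm{Res}(\mathcal{I}_t,\lambda|\Xi).$$ (ii) Let $(\Phi,\overline{\xi}(\cdot))$ be $\xi$-regular, and let $\Gamma$ be the induced dual vector field. Whenever $\widehat{\theta}=[\widehat{\xi};\widehat{\eta}]\in\Theta$, we have $$\epsilon_{\rm VI}(\widehat{\eta}\,|\,\Gamma,H)\leq\epsilon_{\rm VI}(\widehat{\theta}\,|\,\Phi,\Theta).$$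
   Context: Notation: $[a;b]$ denotes vertical concatenation, i.e. the pair $(a,b)$ in the product of Euclidean spaces. Setting. $\mathcal{X},\mathcal{H}$ are Euclidean spaces, $\Theta\subset\mathcal{X}\times\mathcal{H}$ is a nonempty convex compact set, $\Xi$ is the projection of $\Theta$ onto $\mathcal{X}$ and $H$ is the projection of $\Theta$ onto $\mathcal{H}$. For $\xi\in\Xi$, $\eta\in H$ set $H_\xi=\{\eta:[\xi;\eta]\in\Theta\}$ and $\Xi_\eta=\{\xi\in\Xi:[\xi;\eta]\in\Theta\}$. $\Phi(\xi,\eta)=[\Phi_\xi(\xi,\eta);\Phi_\eta(\xi,\eta)]:\Theta\to\mathcal{X}\times\mathcal{H}$ is a continuous monotone vector field (subscripts denote the $\mathcal{X}$- and $\mathcal{H}$-components; monotone means $\langle\Phi(\theta)-\Phi(\theta'),\theta-\theta'\rangle\ge0$ for all $\theta,\theta'\in\Theta$). $\eta$-regularity. $\overline{\eta}(\cdot)$ is a function on $\Xi$ such that for every $\xi\in\Xi$, $\overline{\eta}(\xi)\in H_\xi$ and $\langle\Phi_\eta(\xi,\overline{\eta}(\xi)),\eta-\overline{\eta}(\xi)\rangle\geq0$ for all $\eta\in H_\xi$. The pair $(\Phi,\overline{\eta}(\cdot))$ is called $\eta$-regular if for every $\xi\in\Xi$ there exists $\Psi(\xi)\in\mathcal{X}$ such that $$\langle\Psi(\xi),\xi'-\xi\rangle\leq\langle\Phi(\xi,\overline{\eta}(\xi)),[\xi';\eta']-[\xi;\overline{\eta}(\xi)]\rangle\quad\forall[\xi';\eta']\in\Theta.$$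 Any such function $\Psi:\Xi\to\mathcal{X}$ is called a primal vector field induced by $(\Phi,\overline{\eta}(\cdot))$. $\xi$-regularity. $\overline{\xi}(\cdot)$ is a function on $H$ such that for every $\eta\in H$, $\overline{\xi}(\eta)\in\Xi_\eta$ and $\langle\Phi_\xi(\overline{\xi}(\eta),\eta),\xi-\overline{\xi}(\eta)\rangle\geq0$ for all $\xi\in\Xi_\eta$. The pair $(\Phi,\overline{\xi}(\cdot))$ is called $\xi$-regular if for every $\eta\in H$ there exists $\Gamma(\eta)\in\mathcal{H}$ such that $$\langle\Gamma(\eta),\eta'-\eta\rangle\leq\langle\Phi(\overline{\xi}(\eta),\eta),[\xi';\eta']-[\overline{\xi}(\eta);\eta]\rangle\quad\forall[\xi';\eta']\in\Theta.$$ Any such function $\Gamma:H\to\mathcal{H}$ is called a dual vector field induced by $(\Phi,\overline{\xi}(\cdot))$. A $t$-step accuracy certificate is a vector $\lambda\in\mathbf{R}^t$ with nonnegative entries summing to 1. For a convex compact set $W$ in a Euclidean space $\mathcal{W}$, a vector field $M:W\to\mathcal{W}$ and a $t$-step execution protocol $\mathcal{I}_t=\{w_i\in W,M(w_i):1\leq i\leq t\}$, the residual is $\mathrm{Res}(\mathcal{I}_t,\lambda|W)=\max_{w\in W}\sum_{i=1}^t\lambda_i\langle M(w_i),w_i-w\rangle$, and the dual gap function is $\epsilon_{\rm VI}(w\,|\,M,W)=\sup_{w'\in W}\langle M(w'),w-w'\rangle$, $w\in W$. *)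

(* Defs.v *)
(* MathComp-Analysis *)
From HB Require Import structures.
From mathcomp Require Import all_boot all_order all_algebra.
From mathcomp Require Import all_classical all_reals all_analysis.
Import Order.TTheory GRing.Theory Num.Theory numFieldNormedType.Exports.

Set Implicit Arguments.
Unset Strict Implicit.
Unset Printing Implicit Defensive.

Local Open Scope classical_set_scope.
Local Open Scope ring_scope.

(* A Euclidean space is a finite-dimensional normed module [V] together with an
   inner product [ip : {dot V for idfun}].  The norm of [V] is used only for its
   topology.  It need not be the norm induced by [ip]: in finite dimension all
   norms give the same compact sets and the same continuous maps. *)

Definition ip_prod (R : realType) (X H : lmodType R)
    (ipX : X -> X -> R) (ipH : H -> H -> R) (u v : X * H) : R :=
  ipX u.1 v.1 + ipH u.2 v.2.

Section VectorFields.
Context {R : realType} {V : lmodType R}.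
Variable ip : V -> V -> R.
Implicit Types (W : set V) (M : V -> V).

(* A vector field on [W] is a total function of which only the values on [W]
   are ever used. *)
Definition monotone_field W M : Prop :=
  forall w w', W w -> W w' -> 0 <= ip (M w - M w') (w - w').

Definition protocol M (t : nat) (w : 'I_t -> V) : 'I_t -> V * V :=
  fun i => (w i, M (w i)).

(* When [W] is nonempty and compact, the supremum is finite and attained: it is
   the maximum of an affine function of [w]. *)
Definition residual (t : nat) (I : 'I_t -> V * V) (lam : 'I_t -> R) W : \bar R :=
  ereal_sup [set (\sum_i lam i * ip (I i).2 ((I i).1 - w))%:E | w in W].

(* The value lies in [\bar R] because [M] may be unbounded on [W]. *)
Definition eps_VI (w : V) M W : \bar R :=
  ereal_sup [set (ip (M w') (w - w'))%:E | w' in W].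

End VectorFields.

Definition accuracy_certificate (R : realType) (t : nat) (lam : 'I_t -> R) :
    Prop :=
  (forall i, 0 <= lam i) /\ \sum_i lam i = 1.

Section InducedFields.
Context {R : realType} {X H : lmodType R}.
Variables (ipX : X -> X -> R) (ipH : H -> H -> R).
Variables (Theta : set (X * H)) (Phi : X * H -> X * H).

Let ip := ip_prod ipX ipH.

Definition eta_selection (etab : X -> H) : Prop :=
  forall xi, (fst @` Theta) xi ->
    xsection Theta xi (etab xi) /\
    forall eta, xsection Theta xi eta ->
      0 <= ipH (Phi (xi, etab xi)).2 (eta - etab xi).

Definition primal_at (etab : X -> H) (xi psi : X) : Prop :=
  forall theta', Theta theta' ->
    ipX psi (theta'.1 - xi) <= ip (Phi (xi, etab xi)) (theta' - (xi, etab xi)).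

Definition eta_regular (etab : X -> H) : Prop :=
  eta_selection etab /\
  forall xi, (fst @` Theta) xi -> exists psi, primal_at etab xi psi.

Definition primal_field (etab : X -> H) (Psi : X -> X) : Prop :=
  forall xi, (fst @` Theta) xi -> primal_at etab xi (Psi xi).

Definition xi_selection (xib : H -> X) : Prop :=
  forall eta, (snd @` Theta) eta ->
    ysection Theta eta (xib eta) /\
    forall xi, ysection Theta eta xi ->
      0 <= ipX (Phi (xib eta, eta)).1 (xi - xib eta).

Definition dual_at (xib : H -> X) (eta gamma : H) : Prop :=
  forall theta', Theta theta' ->
    ipH gamma (theta'.2 - eta) <=
      ip (Phi (xib eta, eta)) (theta' - (xib eta, eta)).

Definition xi_regular (xib : H -> X) : Prop :=
  xi_selection xib /\
  forall eta, (snd @` Theta) eta -> exists gamma, dual_at xib eta gamma.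

Definition dual_field (xib : H -> X) (Gamma : H -> H) : Prop :=
  forall eta, (snd @` Theta) eta -> dual_at xib eta (Gamma eta).

End InducedFields.

(* Main.v *)
(* Everything comes from testing the regularity inequality at points of Theta.
   At two points of the graph of etab, the two inequalities for Psi add up to
   the monotonicity inequality of Phi, with signs that make Psi monotone.
   Monotonicity of Phi gives
     <Phi w, theta_i - w> <= <Phi theta_i, theta_i - w>,
   and averaging it with weights lambda_i bounds the gap by the residual; the
   inequality defining Psi (resp. Gamma) then compares the residuals (resp. the
   gaps) term by term. *)
Require Import Defs.
From HB Require Import structures.
From mathcomp Require Import all_boot all_order all_algebra.
From mathcomp Require Import all_classical all_reals all_analysis.
From mathcomp Require Import ring lra.
Import Order.TTheory GRing.Theory Num.Theory numFieldNormedType.Exports.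
Local Open Scope classical_set_scope.
Local Open Scope ring_scope.

Set Implicit Arguments.
Unset Strict Implicit.
Unset Printing Implicit Defensive.

Section InnerProduct.
Context {R : realType} {X H : lmodType R}.
Variables (ipX : {dot X for idfun}) (ipH : {dot H for idfun}).
Local Notation ip := (ip_prod ipX ipH).

(** [ip_prod] is a bare function, so its bilinearity is derived from that of the two components. *)
Lemma ip_prodBl u v w : ip (u - v) w = ip u w - ip v w.
Proof. by rewrite /ip_prod /= !linearBl; ring. Qed.

Lemma ip_prodDr u v w : ip u (v + w) = ip u v + ip u w.
Proof. by rewrite /ip_prod /= !linearDr; ring. Qed.

Lemma ip_prodNr u v : ip u (- v) = - ip u v.
Proof. by rewrite /ip_prod /= !linearNr; ring. Qed.

Lemma ip_prodBr u v w : ip u (v - w) = ip u v - ip u w.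
Proof. by rewrite ip_prodDr ip_prodNr. Qed.

Lemma ip_prodZr a u v : ip u (a *: v) = a * ip u v.
Proof. by rewrite /ip_prod /= !linearZr_LR /= mulrDr. Qed.

Lemma ip_prod0r u : ip u 0 = 0.
Proof. by rewrite -(scale0r 0) ip_prodZr mul0r. Qed.

Lemma ip_prod_sumr u t (F : 'I_t -> X * H) :
  ip u (\sum_i F i) = \sum_i ip u (F i).
Proof. by apply: (big_morph (ip u)); [exact: ip_prodDr|exact: ip_prod0r]. Qed.

Lemma primal_field_monotone (Theta : set (X * H)) Phi etab Psi :
  monotone_field ip Theta Phi -> eta_selection ipH Theta Phi etab ->
  primal_field ipX ipH Theta Phi etab Psi ->
  monotone_field ipX (fst @` Theta) Psi.
Proof.
move=> Phi_mono etabP PsiP x x' xT x'T.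
(* The graph of [etab] lies in [Theta]: its points can be used both in the monotonicity of [Phi] and
   as test points for [Psi]. *)
have graph z : (fst @` Theta) z -> Theta (z, etab z).
  by move=> /etabP[+ _]; rewrite /xsection /= inE.
have := Phi_mono _ _ (graph _ xT) (graph _ x'T).
have := PsiP _ xT _ (graph _ x'T).
have := PsiP _ x'T _ (graph _ xT).
(* Once expanded into single pairings, the claim is the sum of the three inequalities. *)
rewrite ip_prodBl !ip_prodBr /= linearBl !linearBr /=; lra.
Qed.

Lemma eps_VI_le_residual (Theta : set (X * H)) Phi t (theta : 'I_t -> X * H)
    lam :
  monotone_field ip Theta Phi -> (forall i, Theta (theta i)) ->
  accuracy_certificate lam ->
  (eps_VI ip (\sum_i lam i *: theta i) Phi Theta
     <= residual ip (protocol Phi theta) lam Theta)%E.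
Proof.
move=> Phi_mono thetaT [lam_ge0 lam_sum1].
apply: ge_ereal_sup => _ [w wT <-].
(* The intermediate value is the residual's objective at the same [w]. *)
apply: (@le_trans _ _
  (\sum_i lam i * ip (Phi (theta i)) (theta i - w))%:E); last first.
  by apply: ereal_sup_ubound; exists w.
(* Since the weights sum to 1, the pairing of [Phi w] with [w] spreads over the sum, and the
   comparison becomes termwise. *)
rewrite lee_fin ip_prodBr ip_prod_sumr -(mul1r (ip _ w)) -lam_sum1.
rewrite mulr_suml -sumrB; apply: ler_sum => i _.
rewrite ip_prodZr -mulrBr -ip_prodBr ler_wpM2l//.
by rewrite -subr_ge0 -ip_prodBl Phi_mono.
Qed.

Lemma residual_le_primal (Theta : set (X * H)) Phi etab Psi t (xi : 'I_t -> X)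
    lam :
  primal_field ipX ipH Theta Phi etab Psi ->
  (forall i, (fst @` Theta) (xi i)) -> (forall i, 0 <= lam i) ->
  (residual ip (protocol Phi (fun i => (xi i, etab (xi i)))) lam Theta
     <= residual ipX (protocol Psi xi) lam (fst @` Theta))%E.
Proof.
move=> PsiP xiT lam_ge0; apply: ge_ereal_sup => _ [w wT <-].
(* The projection [w.1] is the competitor in the smaller space; each term is the inequality for
   [Psi] at [xi i], tested at [w], with signs reversed. *)
apply: (@le_trans _ _ (\sum_i lam i * ipX (Psi (xi i)) (xi i - w.1))%:E).
  rewrite lee_fin; apply: ler_sum => i _; rewrite ler_wpM2l//=.
  have := PsiP _ (xiT i) _ wT.
  rewrite !ip_prodBr !linearBr /=; lra.
by apply: ereal_sup_ubound; exists w.1 => //; exists w.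
Qed.

(** Each [e] lifts to the point [(xib e, e)] of [Theta], which competes in the gap of [Phi]; the
    inequality for [Gamma] at [e], tested at [theta], compares the two values. *)
Lemma eps_VI_dual_le (Theta : set (X * H)) Phi xib Gamma theta :
  xi_selection ipX Theta Phi xib ->
  dual_field ipX ipH Theta Phi xib Gamma -> Theta theta ->
  (eps_VI ipH theta.2 Gamma (snd @` Theta) <= eps_VI ip theta Phi Theta)%E.
Proof.
move=> xibP GammaP thetaT; apply: ge_ereal_sup => _ [e eT <-].
have [+ _] := xibP _ eT; rewrite /ysection /= inE => graph.
apply: (@le_trans _ _ (ip (Phi (xib e, e)) (theta - (xib e, e)))%:E).
  by rewrite lee_fin; exact: GammaP.
by apply: ereal_sup_ubound; exists (xib e, e).
Qed.

End InnerProduct.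

Theorem proposition5 (R : realType) (n m : nat) (X H : normedModType R)
    (finX : Vector.axiom n X) (finH : Vector.axiom m H)
    (ipX : {dot X for idfun}) (ipH : {dot H for idfun})
    (Theta : set (X * H)) (Phi : X * H -> X * H) (etab : X -> H)
    (Theta_neq0 : Theta !=set0)
    (Theta_convex : convex_set (Theta : set (convex_lmodType (X * H)%type)))
    (Theta_compact : compact Theta)
    (Phi_continuous : {within Theta, continuous Phi})
    (Phi_monotone : monotone_field (ip_prod ipX ipH) Theta Phi)
    (Phi_eta_regular : eta_regular ipX ipH Theta Phi etab) :
  (forall Psi : X -> X, primal_field ipX ipH Theta Phi etab Psi ->
    monotone_field ipX (fst @` Theta) Psi /\
    forall (t : nat) (xi : 'I_t -> X) (lam : 'I_t -> R),
      (forall i, (fst @` Theta) (xi i)) ->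
      accuracy_certificate lam ->
      let theta : 'I_t -> X * H := fun i => (xi i, etab (xi i)) in
      let I_t := protocol Psi xi in
      let J_t := protocol Phi theta in
      (eps_VI (ip_prod ipX ipH) (\sum_i lam i *: theta i) Phi Theta
         <= residual (ip_prod ipX ipH) J_t lam Theta)%E /\
      (residual (ip_prod ipX ipH) J_t lam Theta
         <= residual ipX I_t lam (fst @` Theta))%E) /\
  (forall (xib : H -> X) (Gamma : H -> H),
    xi_regular ipX ipH Theta Phi xib ->
    dual_field ipX ipH Theta Phi xib Gamma ->
    forall (xih : X) (etah : H), Theta (xih, etah) ->
      (eps_VI ipH etah Gamma (snd @` Theta)
         <= eps_VI (ip_prod ipX ipH) (xih, etah) Phi Theta)%E).
Proof.
have [etabP _] := Phi_eta_regular.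
split=> [Psi PsiP|xib Gamma [xibP _] GammaP xih etah thetaT].
  split=> [|t xi lam xiT lamP]; first exact: primal_field_monotone PsiP.
  split; last by apply: residual_le_primal => //; case: lamP.
  apply: eps_VI_le_residual => // i.
  (* The selection property places each [theta i] in [Theta]. *)
  by have [+ _] := etabP _ (xiT i); rewrite /xsection /= inE.
exact: (eps_VI_dual_le xibP GammaP thetaT).
Qed.
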